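(* Let $n\ge 3$, let $F$ be an infinite field of characteristic $\ne 2$ which is an NFT-field, let $Z$ be an abelian group with $Z\equiv F^\times$, and let $H=\mathrm{T}_n(F,f,Z)$ where $f\in S^2(B_n(F),Z)$ is CoT. Then $H\equiv \mathrm{T}_n(F)$.
   Context: $\equiv$ between groups denotes elementary equivalence in the language of groups. $F^\times$ is the multiplicative group of $F$. $F$ is an NFT-field (field of number field type) if the torsion subgroup of $F^\times$ is finite; then $F^\times=T(F^\times)\times B(F^\times)$ with $T(F^\times)$ the torsion subgroup and $B(F^\times)$ torsion-free. An abelian group $Z\equiv F^\times$ has a similar decomposition $Z=T(Z)\times B(Z)$. $\mathrm{T}_n(F)$ is the group of invertible upper triangular matrices, $\mathrm{UT}_n(F)$ the group of upper unitriangular matrices. $d_i(\alpha)$ is the diagonal matrix with $\alpha$ in position $i$ and $1$ elsewhere; $B_n(F)=\prod_{i=1}^{n-1}d_i(F^\times)\cong(F^\times)^{n-1}$. For abelian groups $B,Z$, $S^2(B,Z)$ is the group of symmetric 2-cocycles: functions $f:B\times B\to Z$ with $f(xy,z)f(x,y)=f(x,yz)f(y,z)$, $f(1,x)=f(x,1)=1$, $f(x,y)=f(y,x)$. Two cocycles are cohomologous if their quotient is a 2-coboundary $(x,y)\mapsto g(x)g(y)g(xy)^{-1}$. For $f\in S^2(B_n(F),Z)$, $\mathrm{T}_n(F,f,Z)$ is the group on $\mathrm{UT}_n(F)\times Z\times B_n(F)$ with product $(u_1,(z_1,b_1))(u_2,(z_2,b_2))=(u_1\cdot b_1u_2b_1^{-1},(z_1z_2f(b_1,b_2),b_1b_2))$.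 CoT (''coboundary on torsion''): since $\mathrm{Ext}(F^\times,Z)\cong \mathrm{Ext}(T(F^\times),Z)\times\mathrm{Ext}(B(F^\times),Z)$, any $g\in S^2(F^\times,Z)$ is cohomologous to a product $g_1g_2$ with $g_1\in S^2(T(F^\times),Z)$, $g_2\in S^2(B(F^\times),Z)$; $g$ is CoT if $g_1$ is a 2-coboundary. Since $\mathrm{Ext}((F^\times)^{n-1},Z)\cong\prod_{i=1}^{n-1}\mathrm{Ext}(F^\times,Z)$, a cocycle $f\in S^2(B_n(F),Z)$ is cohomologous to a product $f_1\cdots f_{n-1}$, with $f_i\in S^2(F^\times,Z)$ (on the $i$-th factor); $f$ is CoT if every $f_i$ is CoT. *)

(* Defs.v *)
From HB Require Import structures.
From mathcomp Require Import all_boot all_order all_algebra.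
From mathcomp Require Import boolp classical_sets functions cardinality.

Set Implicit Arguments.
Unset Strict Implicit.
Unset Printing Implicit Defensive.

Import GRing.Theory.

Local Open Scope group_scope.

(** * First-order language of groups *)

Inductive gterm : Type :=
| GVar of nat
| GOne
| GMul of gterm & gterm
| GInv of gterm.

(* Semantics is classical, so the connectives below are complete. *)
Inductive gformula : Type :=
| GFalse
| GEq of gterm & gterm
| GImp of gformula & gformula
| GAll of nat & gformula.

Fixpoint gterm_fv (t : gterm) : seq nat :=
  match t with
  | GVar n => [:: n]
  | GOne => [::]
  | GMul t1 t2 => gterm_fv t1 ++ gterm_fv t2
  | GInv t1 => gterm_fv t1
  end.

Fixpoint gformula_fv (p : gformula) : seq nat :=
  match p with
  | GFalse => [::]
  | GEq t1 t2 => gterm_fv t1 ++ gterm_fv t2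
  | GImp p1 p2 => gformula_fv p1 ++ gformula_fv p2
  | GAll n p1 => [seq m <- gformula_fv p1 | m != n]
  end.

Definition gsentence (p : gformula) : Prop := gformula_fv p = [::].

Fixpoint geval (G : baseGroupType) (e : nat -> G) (t : gterm) : G :=
  match t with
  | GVar n => e n
  | GOne => 1
  | GMul t1 t2 => geval e t1 * geval e t2
  | GInv t1 => (geval e t1)^-1
  end.

Fixpoint gholds (G : baseGroupType) (e : nat -> G) (p : gformula) : Prop :=
  match p with
  | GFalse => False
  | GEq t1 t2 => geval e t1 = geval e t2
  | GImp p1 p2 => gholds e p1 -> gholds e p2
  | GAll n p1 => forall x : G, gholds [eta e with n |-> x] p1
  end.

(* The valuation is irrelevant for a sentence. *)
Definition gmodels (G : baseGroupType) (p : gformula) : Prop :=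
  gholds (fun _ => 1 : G) p.

Definition elem_equiv (G H : baseGroupType) : Prop :=
  forall p : gformula, gsentence p -> (gmodels G p <-> gmodels H p).

(** * Subgroups as groups *)

Record subgroup (G : groupType) : Type :=
  Subgroup { sg_pred :> {pred G}; sg_closed : group_closed sg_pred }.

Record subgrp (G : groupType) (S : subgroup G) : Type :=
  SubGrp { sgval : G; sgvalP : sgval \in S }.

HB.instance Definition _ (G : groupType) (S : subgroup G) :=
  [isSub for @sgval G S].
HB.instance Definition _ (G : groupType) (S : subgroup G) :=
  [Choice of subgrp S by <:].
HB.instance Definition _ (G : groupType) (S : subgroup G) :=
  SubChoice_isSubGroup.Build G (fun x => x \in S) (subgrp S) (sg_closed S).

(** * The multiplicative group of a field *)

Record units_of (F : fieldType) : Type :=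
  UnitsOf { fuval : F; fuvalP : fuval != 0%R }.

HB.instance Definition _ (F : fieldType) :=
  [isSub for @fuval F].
HB.instance Definition _ (F : fieldType) := [Choice of units_of F by <:].

Definition fu_one (F : fieldType) : units_of F := @UnitsOf F 1%R (oner_neq0 F).

Definition fu_mul (F : fieldType) (x y : units_of F) : units_of F :=
  @UnitsOf F (val x * val y)%R (mulf_neq0 (valP x) (valP y)).

Definition fu_inv (F : fieldType) (x : units_of F) : units_of F :=
  @UnitsOf F ((val x)^-1)%R (invr_neq0 (valP x)).

Fact fu_mulA (F : fieldType) : associative (@fu_mul F).
Proof. by move=> x y z; apply/val_inj/mulrA. Qed.
Fact fu_mulC (F : fieldType) : commutative (@fu_mul F).
Proof. by move=> x y; apply/val_inj/mulrC. Qed.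
Fact fu_mul1 (F : fieldType) : left_id (fu_one F) (@fu_mul F).
Proof. by move=> x; apply/val_inj/mul1r. Qed.
Fact fu_mulV (F : fieldType) :
  left_inverse (fu_one F) (@fu_inv F) (@fu_mul F).
Proof. by move=> x; apply/val_inj/mulVf/(valP x). Qed.
Fact fu_mul1r (F : fieldType) : right_id (fu_one F) (@fu_mul F).
Proof. by move=> x; rewrite fu_mulC fu_mul1. Qed.
Fact fu_mulVr (F : fieldType) :
  right_inverse (fu_one F) (@fu_inv F) (@fu_mul F).
Proof. by move=> x; rewrite fu_mulC fu_mulV. Qed.

HB.instance Definition _ (F : fieldType) := isGroup.Build (units_of F)
  (@fu_mulA F) (@fu_mul1 F) (@fu_mul1r F) (@fu_mulV F) (@fu_mulVr F).

Lemma units_mulC (F : fieldType) (x y : units_of F) : x * y = y * x.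
Proof. exact: fu_mulC. Qed.

(** * Torsion *)

Definition is_torsion (G : groupType) (x : G) : Prop :=
  exists2 m : nat, (0 < m)%N & x ^+ m = 1.

Definition torsion (F : fieldType) : {pred units_of F} :=
  fun x => `[< is_torsion x >].

Fact torsion_group_closed (F : fieldType) : group_closed (@torsion F).
Proof.
split; first by apply/asboolP; exists 1%N.
move=> x y /asboolP[m m0 xm] /asboolP[k k0 yk]; apply/asboolP.
exists (m * k)%N; first by rewrite muln_gt0 m0.
have xV : commute x y^-1 by exact: units_mulC.
by rewrite expgMn // expgnA xm expg1n mul1g mulnC expgnA expVgn yk invg1 expg1n.
Qed.

Definition Tor_subgroup (F : fieldType) : subgroup (units_of F) :=
  Subgroup (torsion_group_closed F).
Notation Tor F := (subgrp (Tor_subgroup F)).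

Definition NFT_field (F : fieldType) : Prop :=
  finite_set [set x : units_of F | is_torsion x].

(* [B] is a torsion-free subgroup with F^* = T(F^* ) x B (internal product);
   T(F^* ) and B then meet trivially because B is torsion-free. *)
Definition torsion_complement (F : fieldType) (B : subgroup (units_of F)) :
    Prop :=
  (forall b, b \in B -> is_torsion b -> b = 1) /\
  (forall x, exists t b, [/\ t \in @torsion F, b \in B & x = t * b]).

(** * Matrix groups *)

Record GLn (n : nat) (F : fieldType) : Type :=
  MkGLn { gl_mx : 'M[F]_n; gl_mxP : gl_mx \in unitmx }.

HB.instance Definition _ n (F : fieldType) :=
  [isSub for @gl_mx n F].
HB.instance Definition _ n (F : fieldType) := [Choice of GLn n F by <:].

Definition gl_one n (F : fieldType) : GLn n F :=
  @MkGLn n F (1%:M)%R (unitmx1 F n).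

Fact gl_mul_proof n (F : fieldType) (A B : GLn n F) :
  (val A *m val B)%R \in unitmx.
Proof. by rewrite unitmx_mul (valP A) (valP B). Qed.

Definition gl_mul n (F : fieldType) (A B : GLn n F) : GLn n F :=
  @MkGLn n F (val A *m val B)%R (gl_mul_proof A B).

Fact gl_inv_proof n (F : fieldType) (A : GLn n F) : invmx (val A) \in unitmx.
Proof. by rewrite unitmx_inv (valP A). Qed.

Definition gl_inv n (F : fieldType) (A : GLn n F) : GLn n F :=
  @MkGLn n F (invmx (val A)) (gl_inv_proof A).

Fact gl_mulA n (F : fieldType) : associative (@gl_mul n F).
Proof. by move=> x y z; apply/val_inj/mulmxA. Qed.
Fact gl_mul1 n (F : fieldType) : left_id (gl_one n F) (@gl_mul n F).
Proof. by move=> x; apply/val_inj/mul1mx. Qed.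
Fact gl_mul1r n (F : fieldType) : right_id (gl_one n F) (@gl_mul n F).
Proof. by move=> x; apply/val_inj/mulmx1. Qed.
Fact gl_mulV n (F : fieldType) :
  left_inverse (gl_one n F) (@gl_inv n F) (@gl_mul n F).
Proof. by move=> x; apply/val_inj/mulVmx/(valP x). Qed.
Fact gl_mulVr n (F : fieldType) :
  right_inverse (gl_one n F) (@gl_inv n F) (@gl_mul n F).
Proof. by move=> x; apply/val_inj/mulmxV/(valP x). Qed.

HB.instance Definition _ n (F : fieldType) := isGroup.Build (GLn n F)
  (@gl_mulA n F) (@gl_mul1 n F) (@gl_mul1r n F) (@gl_mulV n F) (@gl_mulVr n F).

Lemma val_glM n (F : fieldType) (A B : GLn n F) :
  val (A * B) = (val A *m val B)%R.
Proof. by []. Qed.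
Lemma val_glV n (F : fieldType) (A : GLn n F) : val (A^-1) = invmx (val A).
Proof. by []. Qed.
Lemma val_gl1 n (F : fieldType) : val (1 : GLn n F) = (1%:M)%R.
Proof. by []. Qed.

(* [is_trig_mx] is the library's predicate for lower triangular matrices. *)
Definition upper_tri n (F : fieldType) : {pred GLn n F} :=
  fun A => is_trig_mx (val A)^T%R.

Definition upper_unitri n (F : fieldType) : {pred GLn n F} :=
  fun A => (A \in @upper_tri n F) && [forall i, val A i i == 1%R].

(* The matrices diag(a_1, .., a_{n-1}, 1); see [diag_last1P]. *)
Definition diag_last1 n (F : fieldType) : {pred GLn n F} :=
  fun A => is_diag_mx (val A) &&
           [forall i : 'I_n, (i.+1 == n) ==> (val A i i == 1%R)].

Lemma upper_triP n (F : fieldType) (A : GLn n F) :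
  reflect (forall i j : 'I_n, (j < i)%N -> val A i j = 0%R)
          (A \in @upper_tri n F).
Proof.
apply: (iffP (@is_trig_mxP _ _ _ (val A)^T%R)) => h i j /h; last by rewrite mxE.
by rewrite mxE.
Qed.

Lemma upper_tri_diag_neq0 n (F : fieldType) (A : GLn n F) (i : 'I_n) :
  A \in @upper_tri n F -> val A i i != 0%R.
Proof.
move=> At; have := valP A; rewrite -unitmx_tr unitmxE (det_trig At) unitfE.
by move/prodf_neq0 => /(_ i isT); rewrite mxE.
Qed.

Lemma upper_triM n (F : fieldType) (A B : GLn n F) :
  A \in @upper_tri n F -> B \in @upper_tri n F -> A * B \in @upper_tri n F.
Proof.
move=> /upper_triP Au /upper_triP Bu; apply/upper_triP => i j ji.
rewrite val_glM mxE big1 // => k _; have [ki|ik] := ltnP k i.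
  by rewrite Au // mul0r.
by rewrite (Bu k j) ?mulr0 // (leq_trans ji ik).
Qed.

Lemma upper_tri_mul_diag n (F : fieldType) (A B : GLn n F) (i : 'I_n) :
  A \in @upper_tri n F -> B \in @upper_tri n F ->
  val (A * B) i i = (val A i i * val B i i)%R.
Proof.
move=> /upper_triP Au /upper_triP Bu.
rewrite val_glM mxE (bigD1 i) //= big1 ?addr0 // => k ki.
have [lt|gt|/val_inj e] := ltngtP k i.
- by rewrite Au // mul0r.
- by rewrite (Bu k i) ?mulr0.
- by rewrite e eqxx in ki.
Qed.

Lemma upper_triV n (F : fieldType) (A : GLn n F) :
  A \in @upper_tri n F -> A^-1 \in @upper_tri n F.
Proof.
move=> At; have /upper_triP Au := At; apply/upper_triP => i j.
move: {2}(n - i)%N (leqnn (n - i)) => m; elim: m i => [|m IHm] i im ji.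
  by move: im; rewrite leqn0 subn_eq0 leqNgt ltn_ord.
have : val (A * A^-1) i j = 0%R.
  by rewrite mulgV val_gl1 mxE -val_eqE /= gtn_eqF.
rewrite val_glM mxE (bigD1 i) //= big1 ?addr0.
  by move/eqP; rewrite mulf_eq0 (negPf (upper_tri_diag_neq0 i At)) /= => /eqP.
move=> k ki; have [lt|gt|/val_inj e] := ltngtP k i.
- by rewrite Au // mul0r.
- rewrite IHm ?mulr0 ?(ltn_trans ji) // -ltnS (leq_trans _ im) //.
  by rewrite ltn_sub2l // (leq_trans gt (ltnW (ltn_ord k))).
- by rewrite e eqxx in ki.
Qed.

Fact upper_tri1 n (F : fieldType) : 1 \in @upper_tri n F.
Proof.
by apply/upper_triP => i j ji; rewrite val_gl1 mxE -val_eqE /= gtn_eqF.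
Qed.

Fact upper_tri_closed n (F : fieldType) : group_closed (@upper_tri n F).
Proof.
by split=> [|A B At Bt]; [exact: upper_tri1 | exact/upper_triM/upper_triV].
Qed.

Lemma upper_tri_inv_diag n (F : fieldType) (A : GLn n F) (i : 'I_n) :
  A \in @upper_tri n F -> val A^-1 i i = ((val A i i)^-1)%R.
Proof.
move=> At; have A0 := upper_tri_diag_neq0 i At; apply: (mulfI A0).
by rewrite -upper_tri_mul_diag ?upper_triV // mulgV val_gl1 mxE eqxx mulfV.
Qed.

Fact upper_unitri_closed n (F : fieldType) : group_closed (@upper_unitri n F).
Proof.
split=> [|A B /andP[At /forallP A1] /andP[Bt /forallP B1]].
  rewrite unfold_in upper_tri1; apply/forallP => i.
  by rewrite val_gl1 mxE eqxx.
have BV := upper_triV Bt; rewrite unfold_in (upper_triM At BV).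
apply/forallP => i; rewrite upper_tri_mul_diag // upper_tri_inv_diag //.
by rewrite (eqP (A1 i)) (eqP (B1 i)) divr1.
Qed.

Lemma diag_upper_tri n (F : fieldType) (A : GLn n F) :
  is_diag_mx (val A) -> A \in @upper_tri n F.
Proof. by move=> Ad; apply: is_diag_mx_is_trig; rewrite is_diag_trmx. Qed.

Fact diag_last1_closed n (F : fieldType) : group_closed (@diag_last1 n F).
Proof.
split=> [|A B /andP[Ad /forallP A1] /andP[Bd /forallP B1]].
  rewrite unfold_in val_gl1 scalar_mx_is_diag; apply/forallP => i.
  by rewrite mxE eqxx eqxx implybT.
have At := diag_upper_tri Ad; have Bt := diag_upper_tri Bd.
have BV := upper_triV Bt; apply/andP; split; last first.
  apply/forallP => i; apply/implyP => ni.
  rewrite upper_tri_mul_diag // upper_tri_inv_diag //.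
  by rewrite (eqP (implyP (A1 i) ni)) (eqP (implyP (B1 i) ni)) divr1.
have BVd : is_diag_mx (val B^-1).
  rewrite is_diag_mxEtrig andbC; apply/andP; split; first exact: BV.
  pose Bt' : GLn n F := @MkGLn n F (val B)^T%R
    (etrans (unitmx_tr (val B)) (valP B)).
  have : Bt'^-1 \in @upper_tri n F.
    by apply: upper_triV; apply: diag_upper_tri; rewrite /= is_diag_trmx.
  by rewrite unfold_in /upper_tri val_glV /= trmx_inv trmxK.
apply/is_diag_mxP => i j ij; rewrite val_glM mxE big1 // => k _.
have [ik|ik] := eqVneq (i : nat) k.
  by rewrite (is_diag_mxP BVd k j) ?mulr0 // -ik.
by rewrite (is_diag_mxP Ad i k) ?mul0r.
Qed.

Definition Tn_subgroup n F : subgroup (GLn n F) :=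
  Subgroup (upper_tri_closed n F).
Notation Tn n F := (subgrp (Tn_subgroup n F)).
Definition UTn_subgroup n F : subgroup (GLn n F) :=
  Subgroup (upper_unitri_closed n F).
Notation UTn n F := (subgrp (UTn_subgroup n F)).
Definition Bn_subgroup n F : subgroup (GLn n F) :=
  Subgroup (diag_last1_closed n F).
Notation Bn n F := (subgrp (Bn_subgroup n F)).

Definition diag_entry n (F : fieldType) (i : 'I_n) (a : units_of F) :
  'M[F]_n := diag_mx (\row_j (if j == i then val a else 1))%R.

Fact diag_entry_unit n (F : fieldType) (i : 'I_n) (a : units_of F) :
  diag_entry i a \in unitmx.
Proof.
rewrite unitmxE det_diag unitfE; apply/prodf_neq0 => j _; rewrite mxE.
by case: ifP => _; [exact: (valP a) | exact: oner_neq0].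
Qed.

(* The matrices d_i(a). *)
Definition dmx n (F : fieldType) (i : 'I_n) (a : units_of F) : GLn n F :=
  MkGLn (diag_entry_unit i a).

Definition last_free n (i : 'I_n.-1) : 'I_n := widen_ord (leq_pred n) i.

Lemma val_prod_dmx n (F : fieldType) (a : 'I_n.-1 -> units_of F) :
  val (\prod_(i < n.-1) dmx (last_free i) (a i)) = (diag_mx
    (\row_j \prod_(i < n.-1) if j == last_free i then val (a i) else 1))%R.
Proof.
elim: (index_enum _) => [|i s IHs].
  rewrite big_nil val_gl1 -diag_const_mx; congr diag_mx.
  by apply/rowP => j; rewrite !mxE big_nil.
rewrite big_cons val_glM IHs mulmx_diag; congr diag_mx.
by apply/rowP => j; rewrite !mxE big_cons.
Qed.

Lemma diag_last1P n (F : fieldType) (A : GLn n F) :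
  A \in @diag_last1 n F <->
  exists a : 'I_n.-1 -> units_of F,
    A = \prod_(i < n.-1) dmx (last_free i) (a i).
Proof.
have prodE (a : 'I_n.-1 -> units_of F) (k : 'I_n.-1) :
    (\prod_(i < n.-1) if last_free k == last_free i then val (a i) else 1)%R
    = val (a k).
  rewrite (bigD1 k) //= eqxx big1 ?mulr1 // => i ik.
  by rewrite -val_eqE /= val_eqE eq_sym (negPf ik).
have prod1 (a : 'I_n.-1 -> units_of F) (j : 'I_n) : j.+1 = n ->
    (\prod_(i < n.-1) if j == last_free i then val (a i) else 1)%R = 1%R.
  move=> jn; rewrite big1 // => i _; rewrite -val_eqE /=.
  by rewrite gtn_eqF // -(succnK j) jn.
split=> [/andP[Ad /forallP A1]|[a ->]]; last first.
  apply/andP; rewrite val_prod_dmx diag_mx_is_diag; split=> //.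
  apply/forallP => j; apply/implyP => /eqP jn.
  by rewrite !mxE eqxx prod1.
have A0 i := upper_tri_diag_neq0 (last_free i) (diag_upper_tri Ad).
exists (fun i => UnitsOf (A0 i)); apply/val_inj; rewrite val_prod_dmx.
apply/matrixP => i j; rewrite mxE mxE; have [<-|ij] := eqVneq i j; last first.
  by rewrite (is_diag_mxP Ad).
have [ni|ni] := eqVneq i.+1 n.
  by rewrite prod1 //; apply/eqP/(implyP (A1 i))/eqP.
have lt : (i < n.-1)%N.
  by rewrite -ltnS (ltn_predK (ltn_ord i)) ltn_neqAle ni ltn_ord.
have -> : i = last_free (Ordinal lt) by exact/val_inj.
by rewrite prodE.
Qed.

(** * Symmetric 2-cocycles *)

(* The value group [Z] is abelian and written additively, so a product of
   cocycles is a sum; the domain [B] is abelian in all uses below. *)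

Definition sym_cocycle (B : groupType) (Z : zmodType) (f : B -> B -> Z) :=
  [/\ forall x y z, (f (x * y)%g z + f x y = f x (y * z)%g + f y z)%R,
      forall x, f 1 x = 0%R, forall x, f x 1 = 0%R
    & forall x y, f x y = f y x].

Record S2 (B : groupType) (Z : zmodType) : Type :=
  MkS2 { s2_fun :> B -> B -> Z; s2P : sym_cocycle s2_fun }.

Definition coboundary (B : groupType) (Z : zmodType) (f : B -> B -> Z) : Prop :=
  exists h : B -> Z, forall x y, f x y = (h x + h y - h (x * y)%g)%R.

Definition cohomologous (B : groupType) (Z : zmodType) (f g : B -> B -> Z) :
    Prop :=
  coboundary (fun x y => f x y - g x y)%R.

(* [p] is g_1 g_2 as a cocycle on F^* = T x B, pulling back g_1 and g_2 along
   the two projections. *)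
Definition is_product_cocycle (F : fieldType) (Z : zmodType)
    (B : subgroup (units_of F)) (g1 : S2 (Tor F) Z)
    (g2 : S2 (subgrp B) Z) (p : S2 (units_of F) Z) : Prop :=
  forall t1 t2 b1 b2,
    p (val t1 * val b1) (val t2 * val b2) = (g1 t1 t2 + g2 b1 b2)%R.

(* The existence of [g1], [g2] as here, and whether [g1] is a coboundary, do
   not depend on which complement [B] of the torsion subgroup is chosen. *)
Definition CoT1 (F : fieldType) (Z : zmodType) (g : S2 (units_of F) Z) : Prop :=
  exists (B : subgroup (units_of F)) (g1 : S2 (Tor F) Z)
         (g2 : S2 (subgrp B) Z) (p : S2 (units_of F) Z),
    [/\ torsion_complement B, is_product_cocycle g1 g2 p, cohomologous g p
      & coboundary g1].

(* The component of b = d_1(a_1) .. d_{n-1}(a_{n-1}) in the i-th factor. *)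
Fact Bn_coord_neq0 n (F : fieldType) (b : Bn n F) (i : 'I_n.-1) :
  val (val b) (last_free i) (last_free i) != 0%R.
Proof.
by have /andP[bd _] := valP b; exact/upper_tri_diag_neq0/diag_upper_tri.
Qed.

Definition Bn_coord n (F : fieldType) (i : 'I_n.-1) (b : Bn n F) : units_of F :=
  UnitsOf (Bn_coord_neq0 b i).

Definition CoT n (F : fieldType) (Z : zmodType) (f : S2 (Bn n F) Z) : Prop :=
  exists fi : 'I_n.-1 -> S2 (units_of F) Z,
    cohomologous f
      (fun b c => \sum_(i < n.-1) fi i (Bn_coord i b) (Bn_coord i c))%R /\
    forall i, CoT1 (fi i).

(** * The groups T_n(F, f, Z) *)

Fact Bn_conj_proof n (F : fieldType) (b : Bn n F) (u : UTn n F) :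
  val b * val u * (val b)^-1 \in @upper_unitri n F.
Proof.
have /andP[bd _] := valP b; have bt := diag_upper_tri bd.
have /andP[ut /forallP u1] := valP u.
have bV := upper_triV bt; have but := upper_triM bt ut.
rewrite unfold_in (upper_triM but bV); apply/forallP => i.
rewrite upper_tri_mul_diag // upper_tri_inv_diag // upper_tri_mul_diag //.
by rewrite (eqP (u1 i)) mulr1 divff // upper_tri_diag_neq0.
Qed.

Definition Bn_conj n (F : fieldType) (b : Bn n F) (u : UTn n F) : UTn n F :=
  @SubGrp _ (UTn_subgroup n F) _ (Bn_conj_proof b u).

Record Tnf n (F : fieldType) (Z : zmodType) (f : S2 (Bn n F) Z) : Type :=
  MkTnf { tnf_val : UTn n F * (Z * Bn n F) }.

HB.instance Definition _ n F Z f := [isNew for @tnf_val n F Z f].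
HB.instance Definition _ n F Z f := [Choice of @Tnf n F Z f by <:].

Section TnfGroup.
Variables (n : nat) (F : fieldType) (Z : zmodType) (f : S2 (Bn n F) Z).

Definition tnf_one : Tnf f := MkTnf f (1, (0%R, 1)).

Definition tnf_mul (x y : Tnf f) : Tnf f :=
  let: (u1, (z1, b1)) := tnf_val x in
  let: (u2, (z2, b2)) := tnf_val y in
  MkTnf f (u1 * Bn_conj b1 u2, ((z1 + z2 + f b1 b2)%R, b1 * b2)).

Definition tnf_inv (x : Tnf f) : Tnf f :=
  let: (u, (z, b)) := tnf_val x in
  MkTnf f (Bn_conj b^-1 u^-1, ((- z - f b (b^-1)%g)%R, b^-1)).

Lemma val_Bn_conj (b : Bn n F) (u : UTn n F) :
  val (Bn_conj b u) = val b * val u * (val b)^-1.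
Proof. by []. Qed.

Lemma Bn_conjM (b : Bn n F) (u v : UTn n F) :
  Bn_conj b (u * v) = Bn_conj b u * Bn_conj b v.
Proof. by apply/val_inj; rewrite valM !val_Bn_conj valM !mulgA mulgVK. Qed.

Lemma Bn_conjA (b c : Bn n F) (u : UTn n F) :
  Bn_conj (b * c) u = Bn_conj b (Bn_conj c u).
Proof. by apply/val_inj; rewrite !val_Bn_conj valM invgM !mulgA. Qed.

Lemma Bn_conj1 (u : UTn n F) : Bn_conj 1 u = u.
Proof. by apply/val_inj; rewrite val_Bn_conj val1 invg1 mulg1 mul1g. Qed.

Lemma Bn_conj_1 (b : Bn n F) : Bn_conj b 1 = 1.
Proof. by apply/val_inj; rewrite val_Bn_conj !val1 mulg1 mulgV. Qed.

Fact tnf_mulA : associative tnf_mul.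
Proof.
move=> [[u1 [z1 b1]]] [[u2 [z2 b2]]] [[u3 [z3 b3]]].
rewrite /tnf_mul /=; congr (MkTnf _ (_, (_, _))); last by rewrite mulgA.
  by rewrite Bn_conjM Bn_conjA mulgA.
case: (s2P f) => cocyc _ _ _.
rewrite -!addrA; congr (_ + _)%R; congr (_ + _)%R.
by rewrite [RHS]addrCA [(f b1 b2 + _)%R]addrC cocyc [(_ + f b2 b3)%R]addrC.
Qed.

Fact tnf_mul1 : left_id tnf_one tnf_mul.
Proof.
move=> [[u [z b]]]; rewrite /tnf_mul /=; case: (s2P f) => _ f1 _ _.
by rewrite Bn_conj1 !mul1g f1 add0r addr0.
Qed.

Fact tnf_mul1r : right_id tnf_one tnf_mul.
Proof.
move=> [[u [z b]]]; rewrite /tnf_mul /=; case: (s2P f) => _ _ f1 _.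
by rewrite Bn_conj_1 !mulg1 f1 !addr0.
Qed.

Fact tnf_mulV : left_inverse tnf_one tnf_inv tnf_mul.
Proof.
move=> [[u [z b]]]; rewrite /tnf_mul /tnf_inv /=; case: (s2P f) => _ _ _ fC.
by rewrite -Bn_conjM !mulVg Bn_conj_1 [f b^-1 b]fC addrAC subrK addNr.
Qed.

Fact tnf_mulVr : right_inverse tnf_one tnf_inv tnf_mul.
Proof.
move=> [[u [z b]]]; rewrite /tnf_mul /tnf_inv /=.
by rewrite -Bn_conjA !mulgV Bn_conj1 mulgV addrA subrK subrr.
Qed.

HB.instance Definition _ := isGroup.Build (Tnf f)
  tnf_mulA tnf_mul1 tnf_mul1r tnf_mulV tnf_mulVr.

End TnfGroup.

(* Main.v *)
Require Import Defs.
From HB Require Import structures.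
From mathcomp Require Import all_boot all_order all_algebra.
From mathcomp Require Import boolp classical_sets functions cardinality filter.
From mathcomp Require Import generic_quotient ring_quotient.

(** Scalar matrices split off from T_n(F): if G is the group of upper
    triangular matrices with last diagonal entry 1, then T_n(F) = G x F^*.
    Since UT_n(F) B_n(F) = G, the group T_n(F, f, Z) would likewise be G x Z if
    f were a coboundary, and G x Z is elementarily equivalent to G x F^* because
    Z is to F^* ([elem_equiv_prod]).  In general f is not a coboundary, but it
    becomes one in an ultrapower, and ultrapowers preserve the theory.

    Fix a nonprincipal ultrafilter D on the natural numbers.  If A is a
    torsion-free abelian group and f a cocycle on A with values in Z, then the
    ultrapower of f, a cocycle on the ultrapower of A with values in the
    ultrapower M of Z, is a coboundary
    ([torsion_free_ultra_coboundary]).  Indeed M is so saturated that every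
    triangular system y_j = d_j y_{j+1} + c_j has a solution
    ([ultrapower_solvable]).  This is exactly what is needed to extend a
    homomorphism into M from a pure subgroup to a larger one of relative rank
    one, since a torsion-free group of rank one is the union of a chain of
    cyclic groups; by Zorn's lemma every extension of a torsion-free abelian
    group by M then splits ([pure_hom_graph_extend]).  A cocycle that is CoT is,
    up to a coboundary, a sum of cocycles pulled back from torsion-free
    complements of the torsion subgroup of F^*, so its ultrapower is a
    coboundary too ([CoT_ultra_coboundary]).  A cochain g that
    trivialises it gives an isomorphism (u, z, b) |-> (u b, z + g(b)) from the
    ultrapower of T_n(F, f, Z) to that of G x Z ([Tnf_equiv_prod]).

    Ultrapowers of groups are handled as sequences compared D-almost
    everywhere; only M is formed as a quotient, because Zorn's lemma is applied
    to homomorphisms into it. *)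

Set Implicit Arguments.
Unset Strict Implicit.
Unset Printing Implicit Defensive.

Import GRing.Theory Num.Theory Order.TTheory.

Local Open Scope group_scope.

(** * Transfer along ultrapowers *)

Section UltrapowerTransfer.
Variables (D : set_system nat) (DU : UltraFilter D).

Lemma ultra_not (P : set nat) : D (~` P)%classic <-> ~ D P.
Proof.
split=> [nP yP|nP]; last by case: (in_ultra_setVsetC P DU).
by have [i []] := filter_ex (filterI nP yP).
Qed.

Lemma ultra_iff (P Q : set nat) :
  D [set i | P i <-> Q i]%classic -> (D P <-> D Q).
Proof.
by move=> PQ; split=> h; apply: filterS (filterI PQ h) => i [[a b]] /=; auto.
Qed.

Lemma ultra_imp (P Q : set nat) :
  D [set i | P i -> Q i]%classic <-> (D P -> D Q).
Proof.
split=> [PQ h|PQ]; first by apply: filterS (filterI PQ h) => i [/= a]; apply: a.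
have [h|h] := pselect (D P); first by apply: filterS (PQ h) => i /= q.
by apply: filterS ((ultra_not P).2 h) => i /= nP /nP.
Qed.

Lemma ultra_cst (P : Prop) : D [set _ | P]%classic <-> P.
Proof.
split=> [h|h]; last by apply: filterS filterT => i _.
by have [i] := filter_ex h.
Qed.

(** The universal quantifier step of Los's theorem. *)
Lemma ultra_forall (T : Type) (t0 : T) (P : nat -> T -> Prop) :
  D [set i | forall x, P i x]%classic <->
  forall x : nat -> T, D [set i | P i (x i)]%classic.
Proof.
split=> [h x|h]; first by apply: filterS h => i /=.
apply: contrapT => /ultra_not nP.
have /choice[x xP] i : exists x, (~ forall y, P i y) -> ~ P i x.
  have [/existsNP[x nx]|h'] := pselect (~ forall y, P i y); first by exists x.
  by exists t0.
have [i [/= a b]] := filter_ex (filterI nP (h x)).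
exact: (xP i a b).
Qed.

(** The hypotheses say that [Psi] induces an isomorphism between the
    ultrapowers of [G] and [H].  An induction on formulas shows that [Psi]
    preserves truth D-almost everywhere, and a constant truth value holds
    D-almost everywhere exactly when it holds, so Los's theorem for [G] and
    for [H] is obtained along the way. *)
Lemma ultra_elem_equiv (G H : groupType) (Psi : (nat -> G) -> (nat -> H)) :
    (forall x y, D [set i |
       Psi (fun j => x j * y j) i = Psi x i * Psi y i]%classic) ->
    (forall x y, D [set i | Psi x i = Psi y i]%classic <->
                 D [set i | x i = y i]%classic) ->
    (forall y, exists x, Psi x = y) ->
  elem_equiv G H.
Proof.
move=> PsiM PsiI PsiS.
have Psi1 : D [set i | Psi (fun=> 1) i = 1]%classic.
  have := PsiM (fun=> 1) (fun=> 1).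
  rewrite (_ : (fun=> 1 * 1) = (fun=> 1)); last by apply/funext => j; rewrite mulg1.
  apply: filterS => i /= e; apply: (@mulgI _ (Psi (fun=> 1) i)).
  by rewrite -e mulg1.
have PsiV x : D [set i | Psi (fun j => (x j)^-1) i = (Psi x i)^-1]%classic.
  have := PsiM x (fun j => (x j)^-1).
  rewrite (_ : (fun j => x j * _) = (fun=> 1)); last by apply/funext => j; rewrite mulgV.
  apply: filterS2 Psi1 => i /= e1 e; apply: (@mulgI _ (Psi x i)).
  by rewrite -e mulgV -e1.
have PsiT t (e : nat -> nat -> G) :
    D [set i | Psi (fun j => geval (fun v => e v j) t) i =
               geval (fun v => Psi (e v) i) t]%classic.
  elim: t => [v||s IHs t IHt|t IHt] //=.
  - by apply: filterS filterT.
  - have := PsiM (fun j => geval (fun v => e v j) s) (fun j => geval (fun v => e v j) t).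
    by apply: filterS3 IHs IHt => i /= -> -> ->.
  - have := PsiV (fun j => geval (fun v => e v j) t).
    by apply: filterS2 IHt => i /= -> ->.
have updE (K : groupType) (e : nat -> nat -> K) (m : nat) (x : nat -> K) i :
    (fun v => [eta e with m |-> x] v i) = [eta (fun v => e v i) with m |-> x i].
  by apply/funext => v /=; case: ifP.
have main p : forall e : nat -> nat -> G,
    D [set i | gholds (fun v => e v i) p]%classic <->
    D [set i | gholds (fun v => Psi (e v) i) p]%classic.
  elim: p => [|s t|p IHp q IHq|m p IHp] e /=.
  - by [].
  - rewrite -PsiI; apply: ultra_iff.
    by apply: filterS2 (PsiT s e) (PsiT t e) => i /= -> ->.
  - by rewrite !ultra_imp IHp IHq.
  - rewrite (ultra_forall 1) (ultra_forall 1).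
    have IH x : D [set i | gholds [eta (fun v => e v i) with m |-> x i] p]%classic
        <-> D [set i | gholds [eta (fun v => Psi (e v) i) with m |-> Psi x i] p]%classic.
      apply: iff_trans (iff_trans _ (IHp [eta e with m |-> x])) _;
        apply: ultra_iff; apply: filterS filterT => i _; rewrite /mkset.
        by have -> := updE G e m x i.
      have <- := updE H (fun v => Psi (e v)) m (Psi x) i.
      suff -> : (fun v => Psi ([eta e with m |-> x] v) i) =
        (fun v => [eta fun v => Psi (e v) with m |-> Psi x] v i) by [].
      by apply/funext => v /=; case: ifP.
    by split=> h x; [have [y <-] := PsiS x; apply/IH | apply/IH].
move=> p _; apply: iff_trans (iff_sym (ultra_cst _)) _.
apply: iff_trans (main p (fun _ _ => 1)) (iff_trans _ (ultra_cst _)).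
by apply: ultra_iff; apply: filterS Psi1 => i /= ->.
Qed.

End UltrapowerTransfer.

Lemma iso_elem_equiv (G H : groupType) (phi : G -> H) :
    {morph phi : x y / x * y} -> injective phi -> (forall y, exists x, phi x = y) ->
  elem_equiv G H.
Proof.
move=> phiM phiI /choice[psi psiK].
have [D [DU _]] := ultraFilterLemma eventually_filter.
refine (ultra_elem_equiv (Psi := fun x i => phi (x i)) DU _ _ _).
- by move=> x y; apply: filterS filterT => i _ /=; rewrite phiM.
- move=> x y; split; apply: filterS => i /=; [exact: phiI|by move=> ->].
- by move=> y; exists (fun i => psi (y i)); apply/funext => i; rewrite psiK.
Qed.

Lemma elem_equiv_trans (G H K : baseGroupType) :
  elem_equiv G H -> elem_equiv H K -> elem_equiv G K.
Proof. by move=> GH HK p ps; apply: iff_trans (GH p ps) (HK p ps). Qed.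

(** * Direct products *)

Definition gnot (p : gformula) := GImp p GFalse.
Definition gor (p q : gformula) := GImp (gnot p) q.

Lemma gholds_or (G : baseGroupType) (e : nat -> G) p q :
  gholds e (gor p q) <-> gholds e p \/ gholds e q.
Proof.
split=> /=; last by case.
by move=> h; have [|/h] := pselect (gholds e p); auto.
Qed.


(** A list of pairs of formulas, the first components about G and the second
    ones about H, stands for a conjunction of disjunctions.  In this form the
    universal quantifier over G x H distributes: if, for all x in G and y in H,
    P(x) or Q(y) holds, then P holds everywhere or Q does. *)
Definition cnf_or (L M : seq (gformula * gformula)) :=
  [seq (gor a.1 b.1, gor a.2 b.2) | a <- L, b <- M].

Fixpoint cnf_not (L : seq (gformula * gformula)) : seq (gformula * gformula) :=
  if L is r :: L' then
    cnf_or [:: (gnot r.1, GFalse); (GFalse, gnot r.2)] (cnf_not L')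
  else [:: (GFalse, GFalse)].

Fixpoint prod_cnf (p : gformula) : seq (gformula * gformula) :=
  match p with
  | GFalse => [:: (GFalse, GFalse)]
  | GEq s t => [:: (GEq s t, GFalse); (GFalse, GEq s t)]
  | GImp p1 p2 => cnf_or (cnf_not (prod_cnf p1)) (prod_cnf p2)
  | GAll n p1 => [seq (GAll n r.1, GAll n r.2) | r <- prod_cnf p1]
  end.

Section FefermanVaught.
Variables (G H : groupType).

Fixpoint cnf_holds (e : nat -> G) (d : nat -> H) (L : seq (gformula * gformula)) :
    Prop :=
  if L is r :: L' then
    (gholds e r.1 \/ gholds d r.2) /\ cnf_holds e d L'
  else True.

Lemma cnf_holds_or e d L M :
  cnf_holds e d (cnf_or L M) <-> cnf_holds e d L \/ cnf_holds e d M.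
Proof.
have cat L1 L2 : cnf_holds e d (L1 ++ L2) <-> cnf_holds e d L1 /\ cnf_holds e d L2.
  by elim: L1 => [|r L1 IH] /=; [tauto | rewrite IH; tauto].
have orl r : cnf_holds e d [seq (gor r.1 b.1, gor r.2 b.2) | b <- M] <->
    (gholds e r.1 \/ gholds d r.2) \/ cnf_holds e d M.
  elim: M => [|b M IH]; first by rewrite /=; tauto.
  rewrite map_cons /cnf_holds -/cnf_holds IH !gholds_or; tauto.
rewrite /cnf_or; elim: L => [|a L IH]; first by rewrite /=; tauto.
rewrite allpairs_cons cat orl IH /=; tauto.
Qed.

Lemma cnf_holds_not e d L : cnf_holds e d (cnf_not L) <-> ~ cnf_holds e d L.
Proof.
elim: L => [|r L IH]; first by rewrite /=; tauto.
rewrite [cnf_not _]/= cnf_holds_or IH /=.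
have [] := pselect (gholds e r.1); have [] := pselect (gholds d r.2).
all: have [] := pselect (cnf_holds e d L); tauto.
Qed.

Lemma cnf_holds_all e d n L :
  cnf_holds e d [seq (GAll n r.1, GAll n r.2) | r <- L] <->
  forall x y, cnf_holds [eta e with n |-> x] [eta d with n |-> y] L.
Proof.
elim: L => [|r L IH] /=; first by split.
rewrite IH; split=> [[h hL] x y|h]; first by split=> //; case: h; auto.
split=> [|x y]; last by have [] := h x y.
apply: contrapT => /not_orP[/existsNP[x nx] /existsNP[y ny]].
by have [[]] := h x y.
Qed.

Lemma geval_pair (e : nat -> G * H) t :
  geval e t = (geval (fun v => (e v).1) t, geval (fun v => (e v).2) t).
Proof.
by elim: t => [v||s IHs t IHt|t IHt] //=; rewrite ?IHs ?IHt //; case: (e v).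
Qed.

(** The Feferman-Vaught theorem for a product of two groups; [prod_cnf] depends
    on the formula only. *)
Lemma gholds_pair (e : nat -> G * H) p :
  gholds e p <->
  cnf_holds (fun v => (e v).1) (fun v => (e v).2) (prod_cnf p).
Proof.
elim: p e => [|s t|p IHp q IHq|n p IHp] e /=.
- by split=> [|[[]]].
- rewrite !geval_pair; split=> [[-> ->]|]; first by split; [left | split=> //; right].
  by case=> -[] // -> [] [] // ->.
- rewrite cnf_holds_or cnf_holds_not -IHp -IHq.
  by have [] := pselect (gholds e p); tauto.
- have updE (x : G * H) :
      ((fun v => ([eta e with n |-> x] v).1) = [eta (fun v => (e v).1) with n |-> x.1])
    * ((fun v => ([eta e with n |-> x] v).2) = [eta (fun v => (e v).2) with n |-> x.2]).
    by split; apply/funext => v /=; case: ifP.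
  rewrite cnf_holds_all; split=> h.
    by move=> x y; have := (IHp _).1 (h (x, y)); rewrite !updE.
  by move=> [x y]; apply/IHp; rewrite !updE.
Qed.
End FefermanVaught.

(** Bounds the free variables, so that a sentence yields clauses made of
    sentences, to which elementary equivalence of the factors applies. *)
Definition cnf_over (s : seq nat) (L : seq (gformula * gformula)) : bool :=
  all (fun r => all (mem s) (gformula_fv r.1 ++ gformula_fv r.2)) L.

Lemma cnf_over_or s L M :
  cnf_over s L -> cnf_over s M -> cnf_over s (cnf_or L M).
Proof.
move=> + sM; rewrite /cnf_or; elim: L => [|a L IH] //= /andP[].
rewrite all_cat => /andP[a1 a2] /IH sL.
rewrite /cnf_over all_cat; apply/andP; split=> //; rewrite all_map.
apply: sub_all sM => b /=; rewrite !all_cat => /andP[b1 b2].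
by rewrite /= a1 a2 b1 b2.
Qed.

Lemma cnf_over_not s L : cnf_over s L -> cnf_over s (cnf_not L).
Proof.
elim: L => [|r L IH] //; rewrite [cnf_over _ _]/= all_cat => /andP[/andP[r1 r2]].
by move/IH => sL; apply: cnf_over_or sL; rewrite /cnf_over /= !cats0 r1 r2.
Qed.

Lemma cnf_over_prod s p :
  all (mem s) (gformula_fv p) -> cnf_over s (prod_cnf p).
Proof.
elim: p s => [|t u|p IHp q IHq|n p IHp] s //=.
- by rewrite cats0 => ->.
- by rewrite all_cat => /andP[/IHp sp /IHq sq]; apply/cnf_over_or/sq/cnf_over_not.
- move=> sp; have /IHp: all (mem (n :: s)) (gformula_fv p).
    apply/allP => m mp; rewrite /= inE; have [//|mn] := eqVneq m n.
    by apply: (allP sp); rewrite mem_filter mn.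
  rewrite /cnf_over all_map; apply: sub_all => r /=.
  by rewrite !all_cat !all_filter => /andP[h1 h2]; apply/andP; split;
    [apply: sub_all h1 | apply: sub_all h2] => m /=; rewrite inE;
    case: eqP.
Qed.

Lemma elem_equiv_prod (G G' H H' : groupType) :
  elem_equiv G G' -> elem_equiv H H' -> elem_equiv (G * H)%type (G' * H')%type.
Proof.
move=> GG' HH' p p0; rewrite /gmodels !gholds_pair.
have: cnf_over [::] (prod_cnf p) by apply: cnf_over_prod; rewrite p0.
have all0 s : all (mem [::]) s -> s = [::] :> seq nat by case: s.
elim: (prod_cnf p) => [|r L IH] //=; rewrite all_cat.
case/andP => /andP[/all0 r1 /all0 r2] /IH ->.
by have := GG' _ r1; have := HH' _ r2; rewrite /gmodels => -> ->.
Qed.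

(** * Extending homomorphisms from pure subgroups *)

Section HomExtension.
Local Open Scope ring_scope.
Variables (E M : zmodType).

Lemma int_subgroup_generator (K : int -> Prop) (k : int) :
    (forall a b, K a -> K b -> K (a - b)) -> K k -> k != 0 ->
  exists2 g, K g & forall a, K a -> exists q, a = q * g.
Proof.
move=> KB Kk k0; have K0 : K 0 by rewrite -(subrr k); apply: KB.
have KN a : K a -> K (- a) by rewrite -sub0r; apply: KB.
have KD a b : K a -> K b -> K (a + b) by move=> Ka /KN Kb; rewrite -[b]opprK; apply: KB.
have KM a q : K a -> K (q * a).
  move=> Ka; elim/int_rec: q => [|n IH|n IH]; first by rewrite mul0r.
    by rewrite -addn1 PoszD mulrDl mul1r; apply: KD.
  by rewrite -addn1 PoszD opprD mulrDl mulN1r; apply/KB.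
pose P n := `[< (0 < n)%N /\ K n%:Z >].
have exP : exists n, P n.
  exists `|k|%N; apply/asboolP; split; first by rewrite absz_gt0.
  by rewrite abszE; case: (ger0P k) => // _; apply: KN.
case: (ex_minnP exP) => m /asboolP[m0 Km] mmin.
exists m%:Z => // a Ka; exists (a %/ m%:Z)%Z.
have am := divz_eq a m%:Z.
have Kr : K (a %% m%:Z)%Z.
  have -> : (a %% m%:Z)%Z = a - (a %/ m%:Z)%Z * m%:Z by rewrite {2}am addrC addKr.
  by apply/KB/KM.
have mz : m%:Z != 0 by rewrite -lt0n in m0 *; case: m m0 {exP Km mmin am Kr}.
have [r0|r0] := eqVneq (a %% m%:Z)%Z 0; first by rewrite {1}am r0 addr0.
have rge := modz_ge0 a mz.
have : P `|(a %% m%:Z)%Z|%N.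
  by apply/asboolP; rewrite absz_gt0; split=> //; rewrite gez0_abs.
move/mmin; rewrite leqNgt -ltz_nat gez0_abs // => /negP[].
by apply: ltz_pmod; rewrite ltz_nat.
Qed.

(** [A] is the graph of a homomorphism into [M] defined on a subgroup of [E]
    with torsion-free quotient.  The empty set is included, so that the
    condition passes to the union of every chain. *)
Definition pure_hom_graph (A : set (E * M)) : Prop :=
  [/\ forall e e' y y', A (e, y) -> A (e', y') -> A (e - e', y - y'),
      forall y, A (0, y) -> y = 0
    & forall m e y, (0 < m)%N -> A (e *+ m, y) -> exists z, A (e, z)].

(** Vanishing of Ext(R, M) for every rank one torsion-free group R, R being
    presented as the union of a chain of cyclic groups with generators x_j,
    x_j = d_j x_{j+1}. *)
Hypothesis solvable : forall (d : nat -> int) (c : nat -> M),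
  exists y : nat -> M, forall j, y j = y j.+1 *~ d j + c j.

(** Let S be the domain of [A].  The elements e such that j! e lies in S + Z x
    form, modulo S, a subgroup of the torsion-free group E/S that embeds in Z,
    hence is generated by some X_j.  As j grows these subgroups exhaust the pure
    closure of S + Z x.  A choice of values y_j at X_j is consistent when it
    solves y_j = d_j y_{j+1} + c_j, where X_j - d_j X_{j+1} lies in S and
    c_j is its image. *)
Lemma pure_hom_graph_adjoin (A : set (E * M)) (x : E) :
    pure_hom_graph A -> A (0, 0) ->
  exists A', [/\ pure_hom_graph A', A `<=` A' & exists y, A' (x, y)]%classic.
Proof.
move=> Ap A0; have [[y Axy]|xA] := pselect (exists y, A (x, y)).
  by exists A; split=> //; exists y.
have [AB Afun Apure] := Ap.
have AN e y : A (e, y) -> A (- e, - y).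
  by move=> /(AB _ _ _ _ A0); rewrite !sub0r.
have AD e e' y y' : A (e, y) -> A (e', y') -> A (e + e', y + y').
  by move=> h /AN h'; rewrite -[e']opprK -[y']opprK; apply: AB.
have AM e y q : A (e, y) -> A (e *~ q, y *~ q).
  move=> h; elim/int_rec: q => [|n IH|n IH]; first by rewrite !mulr0z.
    by rewrite -addn1 PoszD !mulrzDr; apply: AD.
  by rewrite -addn1 PoszD opprD !mulrzDr !mulrN1z; apply: AB.
pose S e := exists y, A (e, y).
have S0 : S 0 by exists 0.
have SB e e' : S e -> S e' -> S (e - e').
  by move=> [y h] [y' h']; exists (y - y'); apply: AB.
have SD e e' : S e -> S e' -> S (e + e').
  by move=> [y h] [y' h']; exists (y + y'); apply: AD.
have SM e q : S e -> S (e *~ q) by move=> [y /(AM _ _ q)]; exists (y *~ q).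
have Spure e q : q != 0 -> S (e *~ q) -> S e.
  case: q => n n0 [y h]; first by apply: (Apure n) h; rewrite lt0n.
  by apply: (Apure n.+1 _ (- y)) => //; have := AN _ _ h; rewrite NegzE mulrNz opprK.
have AC (e : E) q m : e *~ q *+ m = e *+ m *~ q.
  by rewrite !pmulrn -!mulrzA mulrC.
have /choice[xk xkP] j : exists xk : E * int, S (xk.1 *+ j`! - x *~ xk.2) /\
    forall e k, S (e *+ j`! - x *~ k) -> exists q, S (e - xk.1 *~ q).
  pose K (k : int) := exists e, S (e *+ j`! - x *~ k).
  have [|||g [e Sg] gP] := @int_subgroup_generator K j`!%:Z.
  - move=> a b [e Se] [e' Se']; exists (e - e').
    have -> : (e - e') *+ j`! - x *~ (a - b) =
        (e *+ j`! - x *~ a) - (e' *+ j`! - x *~ b).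
      by rewrite mulrnBl mulrzBr !opprB addrACA [RHS]addrACA [- _ - _]addrC.
    exact: SB.
  - by exists x; rewrite -pmulrn subrr.
  - by rewrite -lt0n fact_gt0.
  exists (e, g); split=> // e' k Se'; have [|q kq] := gP k; first by exists e'.
  exists q; apply: (Spure _ j`!%:Z); first by rewrite -lt0n fact_gt0.
  rewrite -pmulrn mulrnBl /= AC.
  have -> : e' *+ j`! - (e *+ j`!) *~ q =
      (e' *+ j`! - x *~ k) - (e *+ j`! - x *~ g) *~ q.
    by rewrite mulrzBl kq [q * g]mulrC mulrzA opprB addrA subrK.
  by apply/SB/SM.
pose X j := (xk j).1.
have X_gen j e k : S (e *+ j`! - x *~ k) -> exists q, S (e - X j *~ q) := (xkP j).2 e k.
have /choice[d dP] j : exists d, S (X j - X j.+1 *~ d).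
  apply: (X_gen _ _ ((xk j).2 * j.+1%:Z)).
  by rewrite factS mulnC mulrnA mulrzA -pmulrn -mulrnBl [_ *+ j.+1]pmulrn; apply/SM/(xkP j).1.
have [c cP] := choice dP.
have [y yP] := solvable d c.
(* the graph of the extension to the subgroup generated by S and X j *)
pose at_level j (a : E * M) := exists q s, A (a.1 - X j *~ q, s) /\ a.2 = s + y j *~ q.
have levelS j a : at_level j a -> at_level j.+1 a.
  case: a => e z [q [s [/= As ->]]]; exists (d j * q), (s + c j *~ q); split.
    have -> : e - X j.+1 *~ (d j * q) = (e - X j *~ q) + (X j - X j.+1 *~ d j) *~ q.
      by rewrite mulrzBl mulrzA addrA subrK.
    by apply/AD/AM.
  by rewrite {1}yP mulrzDl mulrzA /= [_ *~ q + _]addrC addrA.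
have level_le j k a : (j <= k)%N -> at_level j a -> at_level k a.
  move=> /subnK <-; elim: (k - j)%N => // n IH /IH; exact: levelS.
exists [set a | exists j, at_level j a]%classic; split; last first.
- have [|q [s h]] := X_gen 0%N x 1; first by rewrite mulr1z mulr1n subrr.
  by exists (s + y 0%N *~ q), 0%N, q, s.
- move=> [e z] Aez; exists 0%N, 0, z; by rewrite !mulr0z subr0 addr0.
split.
- move=> e e' z z' [j ej] [k ek].
  have [q [s [/= As ->]]] := level_le _ _ _ (leq_maxl j k) ej.
  have [q' [s' [/= As' ->]]] := level_le _ _ _ (leq_maxr j k) ek.
  exists (maxn j k), (q - q'), (s - s') => /=; split; last first.
    by rewrite mulrzBr opprD addrACA.
  have -> : e - e' - X (maxn j k) *~ (q - q') =
      (e - X (maxn j k) *~ q) - (e' - X (maxn j k) *~ q').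
    by rewrite mulrzBr !opprB addrACA [RHS]addrACA [- _ - _]addrC.
  exact: AB.
- move=> z [j [q [s [/= As ->]]]]; have [q0|q0] := eqVneq q 0.
    by move: As; rewrite q0 !mulr0z subr0 addr0; apply: Afun.
  case: xA; have [|q' Sq'] := X_gen j x j`!%:Z; first by rewrite -pmulrn subrr.
  have SX : S (X j).
    by apply: (Spure _ (- q)); rewrite ?oppr_eq0 //; exists s; rewrite mulrNz -sub0r.
  by rewrite -[x](subrK (X j *~ q')); apply/SD/SM.
- move=> m e z m0 [j [q [s [/= As _]]]].
  have mj0 : (0 < m * j`!)%N by rewrite muln_gt0 m0 fact_gt0.
  (* if e *+ m occurs at level j, then e occurs at any level J such that
     m * j! divides J! *)
  have /dvdnP[t tE] : (m * j`! %| (m * j`!)`!)%N by rewrite dvdn_fact // mj0 /=.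
  have [|q' [s' As']] := X_gen (m * j`!)%N e ((xk j).2 * q * t%:Z); last first.
    by exists (s' + y (m * j`!)%N *~ q'), (m * j`!)%N, q', s'.
  rewrite tE mulnC !mulrnA mulrzA -pmulrn -mulrnBl [_ *+ t]pmulrn; apply: (SM).
  have -> : e *+ m *+ j`! - x *~ ((xk j).2 * q) =
      (e *+ m - X j *~ q) *~ j`!%:Z + (X j *+ j`! - x *~ (xk j).2) *~ q.
    by rewrite !mulrzBl -!pmulrn mulrzA addrA AC subrK.
  by apply: SD; apply: SM; [exists s | apply: (xkP j).1].
Qed.

(** Zorn's lemma on graphs: by [pure_hom_graph_adjoin] a maximal one is
    total. *)
Lemma pure_hom_graph_extend (A : set (E * M)) :
    pure_hom_graph A -> A (0, 0) ->
  exists2 r : E -> M, forall e e', r (e - e') = r e - r e'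
    & forall e y, A (e, y) -> r e = y.
Proof.
move=> Ap A0.
(* Zorn_bigcup also considers the empty chain, hence the guard *)
pose P (X : set (E * M)) := pure_hom_graph X /\ ((exists a, X a) -> A `<=` X)%classic.
have [|B [[Bp BA] Bmax]] := @Zorn_bigcup _ P.
  move=> F FP Ftot; split; last first.
    by move=> [a [X FX Xa]] b Ab; exists X => //; apply: (FP X FX).2 Ab; exists a.
  have common a b X Y : F X -> F Y -> X a -> Y b -> exists Z, [/\ F Z, Z a & Z b].
    move=> FX FY Xa Yb; have [XY|YX] := Ftot X Y FX FY.
      by exists Y; split=> //; apply: XY.
    by exists X; split=> //; apply: YX.
  split.
  - move=> e e' y y' [X FX Xa] [Y FY Yb].
    have [W [FW Wa Wb]] := common _ _ _ _ FX FY Xa Yb.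
    by exists W => //; case: (FP W FW).1 => h _ _; apply: h.
  - by move=> y [X FX]; case: (FP X FX).1 => _ h _; apply: h.
  - move=> m e y m0 [X FX]; case: (FP X FX).1 => _ _ h /(h _ _ _ m0)[z Xz].
    by exists z, X.
have {}BA : (A `<=` B)%classic.
  apply: contrapT => nAB; apply: (Bmax A); last by split=> // _ a.
  have B0 a : ~ B a by move=> Ba; apply: nAB; apply: BA; exists a.
  by split=> // a /B0.
have B00 := BA _ A0.
have /choice[r rP] e : exists y, B (e, y).
  have [B' [B'p BB' [y B'y]]] := pure_hom_graph_adjoin e Bp B00.
  exists y; apply: contrapT => nB; apply: (Bmax B'); last first.
    by split=> // _; apply: subset_trans BB'.
  by split=> // /(_ _ B'y).
have [BB Bfun _] := Bp.
have rE e y : B (e, y) -> r e = y.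
  move=> Bey; apply/eqP; rewrite -subr_eq0; apply/eqP/Bfun.
  by rewrite -(subrr e); apply: BB.
by exists r => [e e'|e y /BA]; apply: rE; apply: BB.
Qed.
End HomExtension.

(** * Ultrapowers of abelian groups *)

Section Ultrapower.
Local Open Scope ring_scope.
Local Open Scope quotient_scope.
Variables (D : set_system nat) (DU : UltraFilter D).

(** The proof that [D] is an ultrafilter is an argument of the predicate because
    the canonical instance stating that it is a subgroup has to be found from
    the predicate alone. *)
Definition null_seq (Z : zmodType) of UltraFilter D : {pred nat -> Z} :=
  fun x => `[< D [set i | x i = 0]%classic >].
#[local] Arguments null_seq : clear implicits.

Fact null_seq_closed (Z : zmodType) : zmod_closed (null_seq Z DU).
Proof.
split=> [|x y /asboolP x0 /asboolP y0]; apply/asboolP.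
  by apply: filterS filterT => i _.
by apply: filterS2 x0 y0 => i /= xi yi; rewrite -[LHS]/(x i - y i) xi yi subrr.
Qed.
HB.instance Definition _ (Z : zmodType) :=
  GRing.isZmodClosed.Build (nat -> Z) (null_seq Z DU) (null_seq_closed Z).

Definition ultrapower (Z : zmodType) : zmodType := Quotient.quot (null_seq Z DU).

Definition ultra_class (Z : zmodType) (x : nat -> Z) : ultrapower Z :=
  \pi_(Quotient.quot (null_seq Z DU)) x.
HB.instance Definition _ (Z : zmodType) := GRing.Additive.copy (@ultra_class Z)
  (\pi_(Quotient.quot (null_seq Z DU))).

Lemma ultra_class_eq (Z : zmodType) (x y : nat -> Z) :
  ultra_class x = ultra_class y <-> D [set i | x i = y i]%classic.
Proof.
have -> : (ultra_class x = ultra_class y) <-> (x - y \in null_seq Z DU).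
  by rewrite Quotient.idealrBE; split=> /eqP.
rewrite unfold_in asboolE; apply: ultra_iff => //.
apply: filterS filterT => i _; rewrite /mkset -[(x - y) i]/(x i - y i).
by split=> [/eqP|->]; rewrite ?subrr // subr_eq0 => /eqP.
Qed.

Lemma ultra_class_surj (Z : zmodType) (a : ultrapower Z) : exists x, ultra_class x = a.
Proof. by exists (repr a); rewrite /ultra_class reprK. Qed.

(** At index i only the first i equations are solved, backwards from the value
    0 at place i.  Since [D] contains the cofinite sets, each equation holds at
    D-almost every index. *)
Lemma ultrapower_solvable (Z : zmodType) (d : nat -> int) (c : nat -> ultrapower Z) :
    (\oo `<=` D)%classic ->
  exists y : nat -> ultrapower Z, forall j, y j = y j.+1 *~ d j + c j.
Proof.
move=> Doo; have /choice[C CE] j := ultra_class_surj (c j).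
pose fix W n j i {struct n} : Z := if n is m.+1 then W m j.+1 i *~ d j + C j i else 0.
exists (fun j => ultra_class (fun i => W (i - j)%N j i)) => j.
rewrite -CE -raddfMz -raddfD; apply/ultra_class_eq; apply: Doo.
exists j.+1 => // i /= ji.
have -> : (i - j = (i - j.+1).+1)%N by rewrite -subSn.
have mulz (x : nat -> Z) k : (x *~ k) i = x i *~ k.
  by case: k => m; rewrite ?NegzE ?mulrNz -!pmulrn natmulfctE.
by rewrite -[RHS]/((_ *~ _) i + C j i) mulz.
Qed.
End Ultrapower.

(** * Cocycles that become coboundaries in the ultrapower *)

Section CocycleExtension.
Variables (A : groupType) (AC : forall x y : A, (x * y)%g = (y * x)%g).
Variables (Z : zmodType) (f : S2 A Z).

(** The abelian extension of [A] by [Z] defined by [f]. *)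
Record cocycle_ext (AC : forall x y : A, (x * y)%g = (y * x)%g) (f : S2 A Z) : Type :=
  CocycleExt { ce_val : Z * A }.
HB.instance Definition _ := [isNew for @ce_val AC f].
HB.instance Definition _ := [Choice of @cocycle_ext AC f by <:].

Local Notation E := (@cocycle_ext AC f).
Implicit Types e : E.

Definition ce_zero : E := CocycleExt AC f (0%R, 1%g).
Definition ce_add e1 e2 : E := CocycleExt AC f
  ((ce_val e1).1 + (ce_val e2).1 + f (ce_val e1).2 (ce_val e2).2,
   (ce_val e1).2 * (ce_val e2).2)%g%R.
Definition ce_opp e : E := CocycleExt AC f
  (- (ce_val e).1 - f (ce_val e).2^-1 (ce_val e).2, (ce_val e).2^-1)%g%R.

Fact ce_addA : associative ce_add.
Proof.
move=> [[z1 a1]] [[z2 a2]] [[z3 a3]]; rewrite /ce_add /=.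
congr (CocycleExt _ _ (_, _)); last by rewrite mulgA.
case: (s2P f) => cocyc _ _ _; rewrite -!addrA; congr (_ + (_ + _))%R.
by rewrite [RHS]addrCA [(f a1 a2 + _)%R]addrC cocyc [(_ + f a2 a3)%R]addrC.
Qed.
Fact ce_addC : commutative ce_add.
Proof.
move=> [[z1 a1]] [[z2 a2]]; rewrite /ce_add /= AC [(z1 + z2)%R]addrC.
by case: (s2P f) => _ _ _ ->.
Qed.
Fact ce_add0 : left_id ce_zero ce_add.
Proof.
move=> [[z a]]; rewrite /ce_add /=; case: (s2P f) => _ f1 _ _.
by rewrite mul1g f1 add0r addr0.
Qed.
Fact ce_addN : left_inverse ce_zero ce_opp ce_add.
Proof.
by move=> [[z a]]; rewrite /ce_add /= mulVg addrAC subrK addNr.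
Qed.
HB.instance Definition _ :=
  GRing.isZmodule.Build E ce_addA ce_addC ce_add0 ce_addN.

Definition ce_proj e : A := (ce_val e).2.
Definition ce_inj (z : Z) : E := CocycleExt AC f (z, 1%g).
Definition ce_lift (a : A) : E := CocycleExt AC f (0%R, a).

Lemma ce_projD e1 e2 : ce_proj (e1 + e2)%R = (ce_proj e1 * ce_proj e2)%g.
Proof. by []. Qed.
Lemma ce_projMn e m : ce_proj (e *+ m)%R = (ce_proj e ^+ m)%g.
Proof. by elim: m => [|m IH] //; rewrite mulrS expgS ce_projD IH. Qed.

Lemma ce_proj1 e : ce_proj e = 1%g <-> exists z, e = ce_inj z.
Proof.
by split=> [|[z ->] //]; case: e => -[z a]; rewrite /ce_proj /= => ->; exists z.
Qed.
Lemma ce_inj_inj : injective ce_inj.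
Proof. by move=> z z' []. Qed.
Lemma ce_injB z z' : ce_inj (z - z')%R = (ce_inj z - ce_inj z')%R.
Proof.
apply/eqP; rewrite eq_sym subr_eq; apply/eqP.
rewrite /GRing.add /= /ce_add /= mul1g.
by case: (s2P f) => _ -> _ _; rewrite addr0 subrK.
Qed.

Lemma ce_liftM a b :
  (ce_lift a + ce_lift b = ce_inj (f a b) + ce_lift (a * b)%g)%R.
Proof.
congr (CocycleExt _ _ (_, _)); rewrite /= ?mul1g //.
by case: (s2P f) => _ -> _ _; rewrite add0r !addr0 add0r.
Qed.
End CocycleExtension.

(** The first condition says that [g] induces a map between the ultrapowers, the
    second one that its coboundary is the cocycle induced by [f]. *)
Definition ultra_coboundary (D : set_system nat) (B : groupType) (Z : zmodType)
    (f : B -> B -> Z) : Prop :=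
  exists g : (nat -> B) -> (nat -> Z),
    (forall x y, D [set i | x i = y i]%classic ->
                 D [set i | g x i = g y i]%classic) /\
    (forall x y, D [set i |
       f (x i) (y i) = (g x i + g y i - g (fun j => (x j * y j)%g) i)%R]%classic).

Section UltraCoboundary.
Local Open Scope ring_scope.
Variables (D : set_system nat) (DU : UltraFilter D).

(** The extension defined by the ultrapower of [f] splits: the identity of the
    ultrapower of [Z] extends to a retraction [r], by [pure_hom_graph_extend],
    where purity comes from [A] being torsion-free.  The values of [r] on the
    standard lift of [A] form the required cochain. *)
Lemma torsion_free_ultra_coboundary (A : groupType) (Z : zmodType) (f : S2 A Z) :
    (forall x y : A, x * y = y * x)%g ->
    (forall a : A, is_torsion a -> a = 1%g) -> (\oo `<=` D)%classic ->
  ultra_coboundary D f.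
Proof.
move=> AC Atf Doo; pose E := @cocycle_ext A Z AC f.
(* the identity of the ultrapower of Z, seen inside that of E *)
pose G := [set a : (nat -> E) * ultrapower DU Z |
  exists2 z, D [set i | a.1 i = ce_inj AC f (z i)]%classic & ultra_class DU z = a.2]%classic.
have [|||r rB rG] := @pure_hom_graph_extend _ _ _ G.
- by move=> d c; apply: ultrapower_solvable.
- split.
  + move=> e e' _ _ [z /= ez <-] [z' /= ez' <-].
    exists (z - z'); last by rewrite raddfB.
    apply: filterS2 ez ez' => i /=.
    by rewrite -[(z - z') i]/(z i - z' i) ce_injB => <- <-.
  + move=> y [z /= z0 <-]; rewrite -(raddf0 (@ultra_class _ DU Z)).
    by apply/ultra_class_eq; apply: filterS z0 => i /= /esym/ce_inj_inj.
  + move=> m e _ m0 [z /= ez _].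
    have pe1 : D [set i | ce_proj (e i) = 1%g]%classic.
      apply: filterS ez => i /= mei; apply: Atf; exists m => //.
      by rewrite -ce_projMn; move: mei; rewrite natmulfctE => ->.
    exists (ultra_class DU (fun i => (ce_val (e i)).1)).
    exists (fun i => (ce_val (e i)).1) => //.
    by apply: filterS pe1 => i /= /ce_proj1[z' ->].
- by exists 0; [apply: filterS filterT => i _|rewrite raddf0].
pose lift (x : nat -> A) : nat -> E := fun i => ce_lift AC f (x i).
have /choice[g gP] x : exists z, ultra_class DU z = r (lift x).
  exact: ultra_class_surj.
exists g; split=> [x y xy|x y].
  apply/ultra_class_eq; rewrite !gP; apply/eqP; rewrite -subr_eq0 -rB; apply/eqP/rG.
  exists 0; last by rewrite raddf0.
  apply: filterS xy => i /= xyi; rewrite -[LHS]/(lift x i - lift y i) /lift xyi.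
  by rewrite subrr.
apply/(@ultra_class_eq _ DU _ (fun i => f (x i) (y i))
  (fun i => g x i + g y i - g (fun j => (x j * y j)%g) i)).
rewrite -[X in _ = ultra_class _ X]/(g x + g y - g (fun j => (x j * y j)%g)).
have rD e e' : r (e + e') = r e + r e'.
  have r0 : r 0 = 0 by have := rB 0 0; rewrite !subrr.
  have rN e1 : r (- e1) = - r e1 by have := rB 0 e1; rewrite r0 !sub0r.
  by rewrite -[e' in LHS]opprK rB rN opprK.
rewrite raddfB raddfD /= !gP -rD -rB; apply/esym/rG.
exists (fun i => f (x i) (y i)) => //; apply: filterS filterT => i _ /=.
rewrite -[LHS]/(lift x i + lift y i - lift (fun j => (x j * y j)%g) i).
by rewrite /lift ce_liftM addrK.
Qed.

Lemma coboundary_ultra (B : groupType) (Z : zmodType) (f : B -> B -> Z) :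
  coboundary f -> ultra_coboundary D f.
Proof.
move=> [h fE]; exists (fun x i => h (x i)); split=> [x y|x y].
  by apply: filterS => i /= ->.
by apply: filterS filterT => i _ /=; rewrite fE.
Qed.

Lemma ultra_coboundaryD (B : groupType) (Z : zmodType) (f f' : B -> B -> Z) :
  ultra_coboundary D f -> ultra_coboundary D f' ->
  ultra_coboundary D (fun x y => f x y + f' x y).
Proof.
move=> [g [gE fE]] [g' [gE' fE']]; exists (fun x i => g x i + g' x i).
split=> x y; first by move=> xy; apply: filterS2 (gE _ _ xy) (gE' _ _ xy) => i /= -> ->.
apply: filterS2 (fE x y) (fE' x y) => i /= -> ->.
by rewrite addrACA -opprD [X in X - _]addrACA.
Qed.

Lemma ultra_coboundary_sum (I : Type) (s : seq I) (B : groupType) (Z : zmodType)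
    (f : I -> B -> B -> Z) :
  (forall i, ultra_coboundary D (f i)) ->
  ultra_coboundary D (fun x y => \sum_(i <- s) f i x y).
Proof.
move=> fP; elim: s => [|i s IH].
  by apply: coboundary_ultra; exists (fun=> 0) => x y; rewrite big_nil addr0 subrr.
have := ultra_coboundaryD (fP i) IH.
by congr ultra_coboundary; apply/funext => x; apply/funext => y; rewrite big_cons.
Qed.

Lemma ultra_coboundary_pullback (B C : groupType) (Z : zmodType) (phi : B -> C)
    (f : C -> C -> Z) :
  {morph phi : x y / (x * y)%g} -> ultra_coboundary D f ->
  ultra_coboundary D (fun x y => f (phi x) (phi y)).
Proof.
move=> phiM [g [gE fE]]; exists (fun x => g (fun i => phi (x i))); split=> x y.
  by move=> xy; apply: gE; apply: filterS xy => i /= ->.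
have := fE (fun i => phi (x i)) (fun i => phi (y i)).
rewrite (_ : (fun j => phi (x j) * phi (y j))%g = (fun j => phi (x j * y j)%g)) //.
by apply/funext => j; rewrite phiM.
Qed.

Lemma ultra_coboundary_cohomologous (B : groupType) (Z : zmodType)
    (f f' : B -> B -> Z) :
  cohomologous f f' -> ultra_coboundary D f' -> ultra_coboundary D f.
Proof.
move=> /coboundary_ultra ff' /(ultra_coboundaryD ff').
by congr ultra_coboundary; apply/funext => x; apply/funext => y; rewrite subrK.
Qed.
End UltraCoboundary.


(** * The cocycles that are CoT *)

Lemma torsion_complement_proj (F : fieldType) (B : subgroup (units_of F)) :
  torsion_complement B ->
  exists (t : units_of F -> Tor F) (b : units_of F -> subgrp B),
    [/\ {morph t : x y / x * y}, {morph b : x y / x * y}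
      & forall x, x = val (t x) * val (b x)].
Proof.
move=> [Btf TB].
have /choice[tb tbE] x : exists tb : Tor F * subgrp B,
    x = val tb.1 * val tb.2.
  by have [t [b [tT bB ->]]] := TB x;
    exists (@SubGrp _ (Tor_subgroup F) t tT, @SubGrp _ B b bB).
have uniq_dec (t t' : Tor F) (b b' : subgrp B) :
    val t * val b = val t' * val b' -> t = t' /\ b = b'.
  move=> tb_eq.
  have quotE : val (t'^-1 * t) = val (b' * b^-1).
    by rewrite !valM !gmulfV; apply: (@mulgI _ (val t')); rewrite mulVKg
      mulgA -tb_eq mulgK.
  have b1 : val (b' * b^-1) = 1.
    apply: Btf; first exact: valP.
    by rewrite -quotE; apply/asboolP; exact: (valP (t'^-1 * t)).
  have eqb : b' = b.
    apply: (@mulIg _ b^-1); rewrite mulgV; apply/val_inj; exact: b1.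
  split=> //; apply: (@mulgI _ t'^-1); rewrite mulVg; apply/val_inj.
  by rewrite quotE b1.
have morph x y : (tb (x * y)).1 = (tb x).1 * (tb y).1 /\
                 (tb (x * y)).2 = (tb x).2 * (tb y).2.
  apply: uniq_dec; rewrite -tbE !valM {1}[x]tbE {1}[y]tbE.
  by rewrite !mulgA; congr (_ * _); rewrite -!mulgA; congr (_ * _); apply: units_mulC.
exists (fun x => (tb x).1), (fun x => (tb x).2); split=> // x y; by have [] := morph x y.
Qed.

(** Up to coboundaries, [g] is the pullback of [g2], which lives on a
    torsion-free group. *)
Lemma CoT1_ultra_coboundary (D : set_system nat) (DU : UltraFilter D)
    (F : fieldType) (Z : zmodType) (g : S2 (units_of F) Z) :
  (\oo `<=` D)%classic -> CoT1 g -> ultra_coboundary D g.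
Proof.
move=> Doo [B [g1 [g2 [p [BT pE gp /(coboundary_ultra DU) g1D]]]]].
apply: ultra_coboundary_cohomologous gp _.
have [t [b [tM bM tbE]]] := torsion_complement_proj BT.
have g2D : ultra_coboundary D g2.
  apply: torsion_free_ultra_coboundary => // [x y|a [m m0 am]].
    by apply/val_inj; rewrite !valM units_mulC.
  apply/val_inj; apply: BT.1; first exact: valP.
  by exists m => //; rewrite -gmulfXn am gmulf1.
have := ultra_coboundaryD DU (ultra_coboundary_pullback DU tM g1D)
                             (ultra_coboundary_pullback DU bM g2D).
congr ultra_coboundary; apply/funext => x; apply/funext => y.
by rewrite [in RHS](tbE x) [in RHS](tbE y) pE.
Qed.

Lemma Bn_coordM n (F : fieldType) (i : 'I_n.-1) :
  {morph @Bn_coord n F i : b c / b * c}.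
Proof.
move=> b c; apply/val_inj; rewrite /= upper_tri_mul_diag //; apply/diag_upper_tri.
  by have /andP[] := valP b.
by have /andP[] := valP c.
Qed.

Lemma CoT_ultra_coboundary (D : set_system nat) (DU : UltraFilter D)
    n (F : fieldType) (Z : zmodType) (f : S2 (Bn n F) Z) :
  (\oo `<=` D)%classic -> CoT f -> ultra_coboundary D f.
Proof.
move=> Doo [fi [ffi fiT]]; apply: ultra_coboundary_cohomologous ffi _.
apply: (ultra_coboundary_sum DU _ (f := fun i b c => fi i (Bn_coord i b) (Bn_coord i c))).
move=> i; apply: (ultra_coboundary_pullback DU); first exact: Bn_coordM.
exact: CoT1_ultra_coboundary.
Qed.

(** * Triangular matrices modulo scalars *)

(** This group is the product UT_n(F) B_n(F), and represents T_n(F) modulo the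
    scalar matrices. *)
Definition tri_last1 n (F : fieldType) : {pred GLn n F} :=
  fun A => (A \in @upper_tri n F) &&
           [forall i : 'I_n, (i.+1 == n) ==> (val A i i == 1%R)].

Fact tri_last1_closed n (F : fieldType) : group_closed (@tri_last1 n F).
Proof.
split=> [|A B /andP[At /forallP A1] /andP[Bt /forallP B1]].
  rewrite unfold_in upper_tri1; apply/forallP => i.
  by rewrite val_gl1 mxE eqxx eqxx implybT.
have BV := upper_triV Bt; rewrite unfold_in (upper_triM At BV).
apply/forallP => i; apply/implyP => ni.
rewrite upper_tri_mul_diag // upper_tri_inv_diag //.
by rewrite (eqP (implyP (A1 i) ni)) (eqP (implyP (B1 i) ni)) divr1.
Qed.
Definition tri_last1_subgroup n F : subgroup (GLn n F) :=
  Subgroup (@tri_last1_closed n F).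
Local Notation T1n n F := (subgrp (tri_last1_subgroup n F)).

Section UnipotentDiagonal.
Variables (n : nat) (F : fieldType).
Implicit Types (u : UTn n F) (b : Bn n F).

Let Bn_upper b : val b \in @upper_tri n F.
Proof. by have /andP[/diag_upper_tri] := valP b. Qed.
Let UT_upper u : val u \in @upper_tri n F.
Proof. by have /andP[] := valP u. Qed.

Lemma UTB_diag u b i : val (val u * val b) i i = val (val b) i i.
Proof.
rewrite upper_tri_mul_diag //.
by have /andP[_ /forallP/(_ i)/eqP->] := valP u; rewrite mul1r.
Qed.

Fact UTB_tri_last1 u b : val u * val b \in @tri_last1 n F.
Proof.
rewrite unfold_in upper_triM //; apply/forallP => i; apply/implyP => ni.
by rewrite UTB_diag; have /andP[_ /forallP/(_ i)/implyP/(_ ni)] := valP b.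
Qed.
Definition UTB_mul u b : T1n n F := @SubGrp _ (tri_last1_subgroup n F) _ (UTB_tri_last1 u b).

Lemma UTB_mul_inj u u' b b' : UTB_mul u b = UTB_mul u' b' -> u = u' /\ b = b'.
Proof.
move=> /(congr1 val)/= e; have bb : b = b'.
  do 2!apply/val_inj; apply/matrixP => i j.
  have /andP[bd _] := valP b; have /andP[bd' _] := valP b'.
  have [<-|ij] := eqVneq i j; first by rewrite -(UTB_diag u) e UTB_diag.
  by rewrite (is_diag_mxP bd) // (is_diag_mxP bd').
by split=> //; apply/val_inj; apply: (@mulIg _ (val b)); rewrite e bb.
Qed.

Lemma UTB_mul_surj (A : T1n n F) : exists u b, UTB_mul u b = A.
Proof.
have /andP[At /forallP A1] := valP A.
pose d : 'M[F]_n := diag_mx (\row_j val (val A) j j)%R.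
have dU : d \in unitmx.
  rewrite unitmxE det_diag unitfE; apply/prodf_neq0 => j _; rewrite mxE.
  exact: upper_tri_diag_neq0.
have dE i : d i i = val (val A) i i by rewrite !mxE eqxx.
have dB : MkGLn dU \in @diag_last1 n F.
  rewrite unfold_in /diag_last1 /= diag_mx_is_diag; apply/forallP => i.
  by rewrite dE; exact: A1.
pose b : Bn n F := @SubGrp _ (Bn_subgroup n F) _ dB.
have uU : val A * (val b)^-1 \in @upper_unitri n F.
  have bV := upper_triV (Bn_upper b); rewrite unfold_in (upper_triM At bV).
  apply/forallP => i; rewrite upper_tri_mul_diag // upper_tri_inv_diag //=; last exact: (Bn_upper b).
  by rewrite dE divff // upper_tri_diag_neq0.
exists (@SubGrp _ (UTn_subgroup n F) _ uU), b.
by apply/val_inj; rewrite /= mulgVK.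
Qed.

Lemma UTB_mulM u u' b b' :
  UTB_mul (u * Bn_conj b u') (b * b') = UTB_mul u b * UTB_mul u' b'.
Proof.
apply/val_inj; rewrite -[LHS]/(val u * (val b * val u' * (val b)^-1) * (val b * val b')).
by rewrite -[RHS]/(val u * val b * (val u' * val b')) !mulgA mulgVK.
Qed.
End UnipotentDiagonal.

(** When [g] trivialises the ultrapower of [f], the map
    (u, z, b) |-> (u b, z + g(b)) is an isomorphism of ultrapowers. *)
Lemma Tnf_equiv_prod (D : set_system nat) (DU : UltraFilter D)
    n (F : fieldType) (Z : zmodType) (f : S2 (Bn n F) Z) :
  ultra_coboundary D f ->
  elem_equiv (Tnf f) (T1n n F * Algebra.to_multiplicative Z)%type.
Proof.
move=> [g [gE fE]].
pose u (x : Tnf f) := (tnf_val x).1.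
pose z (x : Tnf f) := (tnf_val x).2.1.
pose b (x : Tnf f) := (tnf_val x).2.2.
have bM x y : b (x * y) = b x * b y by case: x y => -[? [? ?]] [[? []]].
have uM x y : u (x * y) = u x * Bn_conj (b x) (u y).
  by case: x y => -[? [? ?]] [[? []]].
have zM x y : z (x * y) = (z x + z y + f (b x) (b y))%R.
  by case: x y => -[? [? ?]] [[? []]].
refine (ultra_elem_equiv DU (Psi := fun x i => (UTB_mul (u (x i)) (b (x i)),
  (z (x i) + g (fun j => b (x j)) i)%R : Algebra.to_multiplicative Z)) _ _ _).
- move=> x y; apply: filterS (fE (fun j => b (x j)) (fun j => b (y j))) => i /= fxy.
  rewrite bM uM zM fxy UTB_mulM; congr (_, _).
  have -> : (fun j => b (x j * y j)) = (fun j => b (x j) * b (y j)).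
    by apply/funext => j; rewrite bM.
  by rewrite -addrA subrK addrACA.
- move=> x y; split=> xy.
    have /gE gxy : D [set i | b (x i) = b (y i)]%classic.
      by apply: filterS xy => i /(congr1 fst)/UTB_mul_inj[].
    apply: filterS2 xy gxy => i /= xyi gxy.
    have [uE bE] := UTB_mul_inj (congr1 fst xyi).
    have /= := congr1 snd xyi; rewrite gxy => /addIr; move: uE bE; rewrite /u /b /z.
    by case: (x i) (y i) => -[? [? ?]] [[? []]] //= ? ? -> -> ->.
  have /gE gxy : D [set i | b (x i) = b (y i)]%classic.
    by apply: filterS xy => i /= ->.
  by apply: filterS2 xy gxy => i /= -> ->.
- move=> y.
  have /choice[ub ubE] i : exists ub, UTB_mul ub.1 ub.2 = (y i).1.
    by have [v [c <-]] := UTB_mul_surj (y i).1; exists (v, c).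
  exists (fun i => MkTnf f ((ub i).1, (((y i).2 - g (fun j => (ub j).2) i)%R, (ub i).2))).
  by apply/funext => i; rewrite /u /b /z /= ubE subrK; case: (y i).
Qed.

(** The isomorphism multiplies a matrix by a scalar; the scalar is recovered as
    the last diagonal entry, which requires 0 < n. *)
Lemma Tn_equiv_prod n (F : fieldType) : (0 < n)%N ->
  elem_equiv (T1n n F * units_of F)%type (Tn n F).
Proof.
case: n => // n _.
have aU (A : T1n n.+1 F) (a : units_of F) : (val a *: val (val A))%R \in unitmx.
  by rewrite unitmxZ ?unitfE ?(valP a) // (valP (val A)).
have aT A a : MkGLn (aU A a) \in @upper_tri n.+1 F.
  apply/upper_triP => i j ji; have /andP[/upper_triP Au _] := valP A.
  by rewrite /= mxE Au ?mulr0.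
have last1 (A : T1n n.+1 F) : val (val A) ord_max ord_max = 1%R.
  by have /andP[_ /forallP/(_ ord_max)/implyP/(_ (eqxx _))/eqP] := valP A.
refine (iso_elem_equiv (phi := fun x => @SubGrp _ (Tn_subgroup n.+1 F) _ (aT x.1 x.2)) _ _ _).
- move=> [A a] [A' a'] /=; do 2!apply/val_inj.
  by rewrite /= -scalemxAl -scalemxAr scalerA.
- move=> [A a] [A' a'] /(congr1 val)/(congr1 val)/= e.
  have aE : a = a'.
    apply/val_inj; have := congr1 (fun M : 'M_n.+1 => M ord_max ord_max) e.
    by rewrite /= !mxE !last1 !mulr1.
  congr (_, _) => //; do 2!apply/val_inj; apply: (scalerI (valP a)).
  by rewrite e aE.
- move=> A; have At : val A \in @upper_tri n.+1 F := valP A.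
  have a0 := upper_tri_diag_neq0 ord_max At; pose a := UnitsOf a0.
  have BU : ((val a)^-1 *: val (val A))%R \in unitmx.
    by rewrite unitmxZ ?unitfE ?invr_neq0 // (valP (val A)).
  have BT : MkGLn BU \in @tri_last1 n.+1 F.
    apply/andP; split.
      apply/upper_triP => i j ji; have /upper_triP Au := At.
      by rewrite /= mxE (Au i j ji) mulr0.
    apply/forallP => i; apply/implyP => /eqP[ni].
    have -> : i = ord_max by exact/val_inj.
    by rewrite /= mxE mulVf.
  exists (@SubGrp _ (tri_last1_subgroup n.+1 F) _ BT, a).
  by do 2!apply/val_inj; rewrite /= scalerA divff // scale1r.
Qed.

Theorem theorem5p12 (n : nat) (F : fieldType) (Z : zmodType)
    (f : S2 (Bn n F) Z) :
  (3 <= n)%N ->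
  infinite_set (@setT F) ->
  2%N \notin [pchar F]%R ->
  NFT_field F ->
  elem_equiv (Algebra.to_multiplicative Z) (units_of F) ->
  CoT f ->
  elem_equiv (Tnf f) (Tn n F).
Proof.
move=> n3 _ _ _ ZF fT.
have [D [DU Doo]] := ultraFilterLemma eventually_filter.
have fD := CoT_ultra_coboundary DU Doo fT.
apply: elem_equiv_trans (Tnf_equiv_prod DU fD) _.
apply: elem_equiv_trans (Tn_equiv_prod F (leq_trans _ n3)) => //.
by apply: elem_equiv_prod ZF => p.
Qed.
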